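(* Let $S$ be a finite set, $r>0$, and let $H:\Delta(S)\times\mathbf R^{|S|}\to\mathbf R$ be a continuous map for which there is a constant $C$ with $$|H(p,q)-H(p,q')|\le C|q-q'|\qquad\forall p\in\Delta(S),\ q,q'\in\mathbf R^{|S|},$$ $$|H(p,q)-H(p',q)|\le C|p-p'|(|q|+1)\qquad\forall p,p'\in\Delta(S),\ q\in\mathbf R^{|S|}.$$ If $w_1$ is a continuous viscosity subsolution and $w_2$ is a continuous viscosity supersolution of $$\min\left\{rw(p)+H(p,Dw(p))\ ;\ -\lambda_{\max}(p,D^2w(p))\right\}=0\qquad\text{in }\Delta(S),$$ then $w_1\le w_2$ in $\Delta(S)$.
   Context: $\Delta(S)\subset\mathbf R^{|S|}$ is the set of probability distributions on $S$. For $p\in\Delta(S)$ let $T_{\Delta(S)}(p):=\{z\in\mathbf R^{|S|}:\exists\varepsilon>0,\ p+\varepsilon z\in\Delta(S),\ p-\varepsilon z\in\Delta(S)\}$. For a symmetric matrix $X\in\mathbf R^{|S|\times|S|}$ let $\lambda_{\max}(p,X):=\sup\{\langle Xz,z\rangle/|z|^2: z\in T_{\Delta(S)}(p)\setminus\{0\}\}$, with $\lambda_{\max}(p,X)=-\infty$ if $T_{\Delta(S)}(p)=\{0\}$. A map $w:\Delta(S)\to\mathbf R$ is a viscosity subsolution of the equation if it is upper semicontinuous and, for any smooth $\phi:\mathbf R^{|S|}\to\mathbf R$ such that $w-\phi$ has a local maximum on $\Delta(S)$ at a point $p\in\Delta(S)$, one has $\min\{rw(p)+H(p,D\phi(p));-\lambda_{\max}(p,D^2\phi(p))\}\le0$.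 It is a viscosity supersolution if it is lower semicontinuous and, for any smooth $\phi:\mathbf R^{|S|}\to\mathbf R$ such that $w-\phi$ has a local minimum on $\Delta(S)$ at $p\in\Delta(S)$, one has $\min\{rw(p)+H(p,D\phi(p));-\lambda_{\max}(p,D^2\phi(p))\}\ge0$. *)

(* Defs.v *)
From HB Require Import structures.
From mathcomp Require Import all_boot all_order all_algebra.
From mathcomp Require Import all_classical all_reals all_analysis.
Set Implicit Arguments.
Unset Strict Implicit.
Unset Printing Implicit Defensive.
Import Order.TTheory GRing.Theory Num.Theory.
Import numFieldNormedType.Exports.
Local Open Scope classical_set_scope.
Local Open Scope ring_scope.

(* R^n is 'rV[R]_n.  For a finite type S the space R^|S| is 'rV[R]_#|S|, the
   coordinate of s : S being enum_rank s.  A map on the simplex is a total map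
   on 'rV[R]_n of which only the values on the simplex are ever used. *)

Section Simplex.
Context {R : realType} {n : nat}.
Implicit Types (u v z p : 'rV[R]_n) (X : 'M[R]_n).

Definition dot u v : R := \sum_(i < n) u 0 i * v 0 i.

(* The library norm `|u| on matrices is the sup norm. *)
Definition enorm u : R := Num.sqrt (dot u u).

Definition simplex : set 'rV[R]_n :=
  [set p | (forall i, 0 <= p 0 i) /\ \sum_(i < n) p 0 i = 1].

Definition tangent p : set 'rV[R]_n :=
  [set z | exists eps : R,
     [/\ 0 < eps, simplex (p + eps *: z) & simplex (p - eps *: z)]].

(* z *m X is the row form of Xz, as X is symmetric.  When tangent p is reduced
   to 0 the supremum is that of the empty set, which is -oo. *)
Definition lambda_max p X : \bar R :=
  ereal_sup [set (dot (z *m X) z / enorm z ^+ 2)%:E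
            | z in [set z | tangent p z /\ z != 0]].

End Simplex.

Section Calculus.
Context {R : realType} {n : nat}.
Implicit Types (phi : 'rV[R]_n -> R) (p : 'rV[R]_n).

Definition partial (i : 'I_n) phi : 'rV[R]_n -> R :=
  fun p => 'D_(delta_mx 0 i) phi p.

Definition gradient phi p : 'rV[R]_n := \row_i partial i phi p.

Definition hessian phi p : 'M[R]_n :=
  \matrix_(i, j) partial i (partial j phi) p.

Fixpoint class_C (k : nat) phi : Prop :=
  if k is k'.+1
  then (forall p, differentiable phi p) /\ forall i, class_C k' (partial i phi)
  else continuous phi.

Definition smooth phi : Prop := forall k, class_C k phi.

End Calculus.

Section Viscosity.
Context {R : realType} {n : nat}.
Implicit Types (w phi : 'rV[R]_n -> R) (p : 'rV[R]_n).

(* The subspace topology makes semicontinuity relative to A; points outside A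
   are isolated in it and impose no condition. *)
Definition lsc_on (A : set 'rV[R]_n) w : Prop :=
  lower_semicontinuous (fun x : subspace A => (w x)%:E).

Definition usc_on (A : set 'rV[R]_n) w : Prop := lsc_on A (fun x => - w x).

Definition local_max_on (A : set 'rV[R]_n) w p : Prop :=
  A p /\ \forall q \near p, A q -> w q <= w p.

Definition local_min_on (A : set 'rV[R]_n) w p : Prop :=
  A p /\ \forall q \near p, A q -> w p <= w q.

Definition hj_operator (r : R) (H : 'rV[R]_n -> 'rV[R]_n -> R) w phi p
    : \bar R :=
  Order.min (r * w p + H p (gradient phi p))%:E
            (- lambda_max p (hessian phi p))%E.

Definition viscosity_subsolution (r : R) (H : 'rV[R]_n -> 'rV[R]_n -> R) w
    : Prop :=
  usc_on simplex w /\
  forall phi, smooth phi ->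
  forall p, local_max_on simplex (fun q => w q - phi q) p ->
    (hj_operator r H w phi p <= 0)%E.

Definition viscosity_supersolution (r : R) (H : 'rV[R]_n -> 'rV[R]_n -> R) w
    : Prop :=
  lsc_on simplex w /\
  forall phi, smooth phi ->
  forall p, local_min_on simplex (fun q => w q - phi q) p ->
    (0 <= hj_operator r H w phi p)%E.

End Viscosity.

(* Main.v *)
Require Import Defs.
From mathcomp Require Import all_boot all_order all_algebra.
From mathcomp Require Import all_classical all_reals all_analysis.
From mathcomp Require Import ring lra.
Set Implicit Arguments.
Unset Strict Implicit.
Unset Printing Implicit Defensive.
Import Order.TTheory GRing.Theory Num.Theory.
Import numFieldNormedType.Exports.
Local Open Scope classical_set_scope.
Local Open Scope ring_scope.

(* The supersolution w2 is concave in the interior of the simplex: otherwise a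
   quadratic with a positive second derivative along a segment touches w2 from
   below. Let T be the homothety of ratio 1 - eta centred at the barycenter,
   and let (p, q) maximize
     w1 p + kap |p|^2 - w2 q - K |T p - q|^2.
   For K large q is interior, since T p is. There w2 is concave and touched from
   below by a parabola with gradient xi = 2K (T p - q), so xi is a supergradient
   of w2 at q. Moving p by h and q by (1 - eta) h does not change the penalty,
   which gives
     w1 (p + h) + kap |p + h|^2 <= w1 p + kap |p|^2 + (1 - eta) <xi, h>:
   w1 is touched from above by a strictly concave quadratic, hence its
   first-order inequality holds at p. The first-order inequalities of w1 and w2 are then
   compared. As q is at distance of order eta from the boundary, the uniform
   continuity of w2 and the supergradient inequality give eta |xi| -> 0 as
   eta -> 0. *)

(** * Euclidean inner product and norm, and comparison with the sup norm *)

Section Euclidean.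
Context {R : realType} {n : nat}.
Implicit Types (u v x : 'rV[R]_n) (a : R).

Lemma dotC u v : dot u v = dot v u.
Proof. by apply: eq_bigr => i _; rewrite mulrC. Qed.

Lemma dotDl u v x : dot (u + v) x = dot u x + dot v x.
Proof. by rewrite -big_split; apply: eq_bigr => i _; rewrite mxE mulrDl. Qed.

Lemma dotZl a u v : dot (a *: u) v = a * dot u v.
Proof. by rewrite [RHS]big_distrr; apply: eq_bigr => i _; rewrite mxE /= mulrA. Qed.

Lemma dotDr u v x : dot x (u + v) = dot x u + dot x v.
Proof. by rewrite dotC dotDl !(dotC x). Qed.

Lemma dotZr a u v : dot u (a *: v) = a * dot u v.
Proof. by rewrite dotC dotZl dotC. Qed.

Lemma dotNl u v : dot (- u) v = - dot u v.
Proof. by rewrite -scaleN1r dotZl mulN1r. Qed.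

Lemma dotNr u v : dot u (- v) = - dot u v.
Proof. by rewrite dotC dotNl dotC. Qed.

Lemma dot0l v : dot 0 v = 0.
Proof. by rewrite -(scale0r 0) dotZl mul0r. Qed.

Lemma dot_delta u i : dot u (delta_mx 0 i) = u 0 i.
Proof.
rewrite /dot (bigD1 i)//= mxE !eqxx mulr1 big1 ?addr0// => j ji.
by rewrite mxE (negPf ji) andbF mulr0.
Qed.

Lemma dot_ge0 u : 0 <= dot u u.
Proof. by apply: sumr_ge0 => i _; rewrite -expr2 sqr_ge0. Qed.

Lemma sqr_coord_le u i : u 0 i ^+ 2 <= dot u u.
Proof.
rewrite /dot (bigD1 i)//= expr2 lerDl sumr_ge0// => j _.
by rewrite -expr2 sqr_ge0.
Qed.

Lemma dot_eq0 u : (dot u u == 0) = (u == 0).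
Proof.
apply/eqP/eqP => [u0|->]; last exact: dot0l.
apply/rowP => i; rewrite mxE; apply/eqP; rewrite -sqrf_eq0 eq_le sqr_ge0 andbT.
by rewrite -u0 sqr_coord_le.
Qed.

Lemma dot_gt0 u : u != 0 -> 0 < dot u u.
Proof. by move=> u0; rewrite lt_neqAle dot_ge0 eq_sym dot_eq0 u0. Qed.

Lemma enorm_sqr u : enorm u ^+ 2 = dot u u.
Proof. by rewrite sqr_sqrtr// dot_ge0. Qed.

Lemma enorm_ge0 u : 0 <= enorm u.
Proof. exact: sqrtr_ge0. Qed.

Lemma enormZ a u : enorm (a *: u) = `|a| * enorm u.
Proof.
by rewrite /enorm dotZl dotZr mulrA -expr2 sqrtrM ?sqr_ge0// sqrtr_sqr.
Qed.

Lemma enormN u : enorm (- u) = enorm u.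
Proof. by rewrite -scaleN1r enormZ normrN1 mul1r. Qed.

Lemma coord_le_enorm u i : `|u 0 i| <= enorm u.
Proof.
rewrite -(@ler_pXn2r _ 2)// ?nnegrE ?enorm_ge0//.
by rewrite enorm_sqr real_normK ?num_real// sqr_coord_le.
Qed.

Lemma dot_le_enorm u v : dot u v <= enorm u * enorm v.
Proof.
have [->|v0] := eqVneq v 0.
  by rewrite dotC dot0l mulr_ge0 ?enorm_ge0.
have vv : 0 < enorm v.
  by rewrite lt_neqAle enorm_ge0 eq_sym sqrtr_eq0 -ltNge dot_gt0.
have [uv|uv] := leP (dot u v) 0.
  by rewrite (le_trans uv)// mulr_ge0 ?enorm_ge0.
rewrite -(@ler_pXn2r _ 2)// ?nnegrE ?mulr_ge0 ?enorm_ge0 ?(ltW uv)//.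
(* Cauchy-Schwarz: the squared norm of |v|^2 u - <u,v> v is |v|^2 (|u|^2 |v|^2 - <u,v>^2). *)
have := dot_ge0 (enorm v ^+ 2 *: u - dot u v *: v).
rewrite !(dotDl, dotDr, dotNl, dotNr, dotZl, dotZr) (dotC v u) -!enorm_sqr.
set V := enorm v ^+ 2; set D := dot u v; set U := enorm u.
rewrite [leRHS](_ : _ = V * ((U * enorm v) ^+ 2 - D ^+ 2)); last first.
  by rewrite /V; ring.
by rewrite pmulr_rge0 ?subr_ge0//; exact: exprn_gt0.
Qed.

Lemma enormD u v : enorm (u + v) <= enorm u + enorm v.
Proof.
rewrite -(@ler_pXn2r _ 2)// ?nnegrE ?addr_ge0 ?enorm_ge0//.
rewrite enorm_sqr !(dotDl, dotDr) (dotC v u) -!enorm_sqr.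
have := dot_le_enorm u v; nra.
Qed.

Lemma normr_lt_coord u a : 0 < a -> (forall i, `|u 0 i| < a) -> `|u| < a.
Proof.
move=> a0 ua; rewrite /Num.norm /= mx_normrE; apply/bigmax_ltP; split => //= -[i j] _.
by rewrite (ord1 i); exact: ua.
Qed.

Lemma coord_le_normr u i : `|u 0 i| <= `|u|.
Proof.
rewrite [leRHS]/Num.norm /= mx_normrE; apply/bigmax_geP; right => /=.
by exists (0, i).
Qed.

Lemma normr_le_enorm u : `|u| <= enorm u.
Proof.
apply/ler_addgt0Pr => e e0; apply/ltW/normr_lt_coord.
  by rewrite ltr_wpDl ?enorm_ge0.
by move=> i; rewrite ltr_pwDr// coord_le_enorm.
Qed.

Lemma continuous_dot (T : topologicalType) (f g : T -> 'rV[R]_n) :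
  (forall i, continuous (fun x : T => f x 0 i)) ->
  (forall i, continuous (fun x : T => g x 0 i)) ->
  continuous (fun x : T => dot (f x) (g x)).
Proof.
move=> cf cg.
have -> : (fun x : T => dot (f x) (g x)) =
    \sum_(i < n) (fun x : T => f x 0 i * g x 0 i).
  by apply/funext => x; rewrite fct_sumE.
elim/big_ind : _ => [x|u v cu cv x|i _ x]; first exact: cvg_cst.
  by apply: cvgD; [exact: cu | exact: cv].
by apply: cvgM; [exact: cf | exact: cg].
Qed.

End Euclidean.

(** * Quadratic test functions and their derivatives *)

Section Quadratic.
Context {R : realType} {n : nat}.
Implicit Types (A : 'M[R]_n) (b p q u v x : 'rV[R]_n) (c : R).

(** [A] may be non-symmetric, so the Hessian is [A + A^T]. Affine maps belong to the family
    ([A = 0]), which makes it stable under partial derivatives. *)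
Definition quadratic A b c p q : R :=
  dot ((q - p) *m A) (q - p) + dot b (q - p) + c.

(** The difference quotient is exactly [L + h * Q], which tends to [L]. *)
Lemma derive_parabola (f : 'rV[R]_n -> R) x v L Q :
  (forall h, f (h *: v + x) = f x + h * L + h ^+ 2 * Q) -> 'D_v f x = L.
Proof.
move=> fE; apply: cvg_lim => //.
apply: (@cvg_trans _ ((fun h : R => L + h * Q) @ 0^')).
  apply: near_eq_cvg; near=> h.
  have h0 : h != 0 by near: h; exact: nbhs_dnbhs_neq.
  by rewrite /= fE -[_ *: _]/(_ * _); field.
have : (fun h : R => L + h * Q) @ 0^' --> L + 0 * Q.
  apply: cvgD; first exact: cvg_cst.
  apply: cvgM; last exact: cvg_cst.
  by apply: cvg_within_filter; exact: cvg_id.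
by rewrite mul0r addr0.
Unshelve. all: by end_near. Qed.

Lemma dot_symmetrize A u v :
  dot (u *m (A + A^T)) v = dot (u *m A) v + dot (v *m A) u.
Proof.
rewrite mulmxDr dotDl; congr (_ + _).
rewrite /dot; under eq_bigr do rewrite mxE big_distrl/=.
rewrite exchange_big /=; apply: eq_bigr => i _.
rewrite [X in _ = X * _]mxE big_distrl/=; apply: eq_bigr => j _.
by rewrite !mxE; ring.
Qed.

Lemma dot_rank1 u v x : dot (u *m (v^T *m v)) x = dot u v * dot v x.
Proof.
rewrite mulmxA (_ : u *m v^T = (dot u v)%:M) ?mul_scalar_mx ?dotZl//.
apply/matrixP => i j; rewrite !ord1 !mxE eqxx mulr1n.
by apply: eq_bigr => k _; rewrite mxE.
Qed.

Lemma quadratic_expand A b c p x v h :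
  quadratic A b c p (h *: v + x) =
  quadratic A b c p x +
    h * (dot ((x - p) *m (A + A^T)) v + dot b v) + h ^+ 2 * dot (v *m A) v.
Proof.
rewrite dot_symmetrize.
rewrite /quadratic -(addrA _ x) mulmxDl -scalemxAl.
by rewrite !(dotDl, dotDr, dotZl, dotZr); ring.
Qed.

Lemma partial_quadratic A b c p i :
  partial i (quadratic A b c p) =
  quadratic 0 (row i (A + A^T)) (b 0 i) p.
Proof.
apply/funext => x.
rewrite /partial (derive_parabola (quadratic_expand A b c p x (delta_mx 0 i))).
rewrite !dot_delta /quadratic mulmx0 dot0l add0r; congr (_ + _).
rewrite !mxE /dot; apply: eq_bigr => j _; rewrite !mxE; ring.
Qed.

Lemma gradient_quadratic A b c p : gradient (quadratic A b c p) p = b.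
Proof.
apply/rowP => i; rewrite mxE partial_quadratic /quadratic subrr mulmx0 dot0l.
by rewrite dotC dot0l !add0r.
Qed.

Lemma hessian_quadratic A b c p x : hessian (quadratic A b c p) x = A + A^T.
Proof.
apply/matrixP => i j; rewrite mxE !partial_quadratic /quadratic mulmx0 dot0l.
by rewrite trmx0 addr0 row0 dot0l !add0r !mxE addrC.
Qed.

Lemma differentiable_dot (f g : 'rV[R]_n -> 'rV[R]_n) x :
  (forall i, differentiable (fun q => f q 0 i) x) ->
  (forall i, differentiable (fun q => g q 0 i) x) ->
  differentiable (fun q => dot (f q) (g q)) x.
Proof.
move=> df dg.
have -> : (fun q => dot (f q) (g q)) =
    \sum_(i < n) (fun q => f q 0 i * g q 0 i).
  by apply/funext => q; rewrite fct_sumE.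
apply: differentiable_sum => i; exact: differentiableM.
Qed.

Lemma differentiable_quadratic A b c p x : differentiable (quadratic A b c p) x.
Proof.
have dB i : differentiable (fun q => (q - p) 0 i) x.
  have -> : (fun q => (q - p) 0 i) = (fun q : 'rV[R]_n => q 0 i) \- cst (p 0 i).
    by apply/funext => q; rewrite /= !mxE.
  apply: differentiableB; first exact: differentiable_coord.
  exact: differentiable_cst.
apply: differentiableD; last exact: differentiable_cst.
apply: differentiableD.
  apply: differentiable_dot => // i.
  have -> : (fun q => ((q - p) *m A) 0 i) = (fun q => dot (q - p) (col i A)^T).
    by apply/funext => q; rewrite mxE; apply: eq_bigr => j _; rewrite !mxE.
  by apply: differentiable_dot => // j; exact: differentiable_cst.
by apply: differentiable_dot => // j; exact: differentiable_cst.
Qed.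

(** Induction on the order with [A], [b], [c] generalized: each partial derivative is again a
    [quadratic] centred at [p]. *)
Lemma smooth_quadratic A b c p : smooth (quadratic A b c p).
Proof.
move=> k; elim: k A b c => [|k IH] A b c.
  by move=> x; apply: differentiable_continuous; exact: differentiable_quadratic.
split; first by move=> x; exact: differentiable_quadratic.
by move=> i; rewrite partial_quadratic; exact: IH.
Qed.

End Quadratic.

(** * Uniform continuity, bounds and maxima on compact sets *)

Section Compactness.
Context {R : realType}.

(** Compactness in near-covering form reduces the claim to [P d] near each point for small [d];
    there half the radius of continuity works, by the triangle inequality. *)
Lemma compact_unif_continuous (V : normedModType R) (A : set V) (w : V -> R) (mu : R) :
  compact A -> {within A, continuous w} -> 0 < mu ->
  exists2 d, 0 < d &
    forall x y, A x -> A y -> `|x - y| < d -> `|w x - w y| < mu.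
Proof.
move=> /compact_near_coveringP cA /subspace_continuousP cw mu0.
pose P (d : R) x := A x -> forall y, A y -> `|x - y| < d -> `|w x - w y| < mu.
have : \forall d \near (0 : R)^'+, A `<=` P d.
  apply: cA => x Ax.
  have /cvgrPdist_lt/(_ _ (divr_gt0 mu0 (ltr0Sn _ 1))) := cw x Ax.
  rewrite /prop_near1 /= nbhs_simpl /= => /nbhs_ballP[e /= e0 we].
  have e20 : 0 < e / 2 by rewrite divr_gt0.
  exists (ball x (e / 2), [set d | d < e / 2]) => /=.
    split; first exact: nbhsx_ballx.
    exact: nbhs_right_lt.
  move=> [y d] /= [xy de] Ay z Az yz.
  rewrite -ball_normE /= in xy we.
  have wy : `|w x - w y| < mu / 2 by apply: we => //=; rewrite (lt_trans xy)//; lra.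
  have wz : `|w x - w z| < mu / 2.
    apply: we => //=; rewrite -(subrKA y) (le_lt_trans (ler_normD _ _))//; lra.
  rewrite -(subrKA (w x)) (le_lt_trans (ler_normD _ _))// (distrC (w y)); lra.
move=> Pd; near (0 : R)^'+ => d; exists d.
  by near: d; exact: nbhs_right_gt.
move=> x y Ax; apply: (_ : A `<=` P d) => //; near: d; exact: Pd.
Unshelve. all: by end_near. Qed.

Lemma compact_fun_bounded (V : topologicalType) (A : set V) (w : V -> R) :
  compact A -> {within A, continuous w} ->
  exists B, forall x, A x -> `|w x| <= B.
Proof.
move=> cA cw; have /ex_strict_bound_gt0[B _ wB] : bounded_set (w @` A).
  exact/compact_bounded/continuous_compact.
by exists B => x Ax; apply/ltW/wB; exists x.
Qed.

Lemma compact_pair_max (V : topologicalType) (A : set V) (f g : V -> R)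
    (h : V * V -> R) :
  A !=set0 -> compact A -> {within A, continuous f} -> {within A, continuous g} ->
  continuous h ->
  exists p q, [/\ A p, A q & forall p' q', A p' -> A q' ->
    f p' + g q' + h (p', q') <= f p + g q + h (p, q)].
Proof.
move=> [a Aa] cA /subspace_continuousP cf /subspace_continuousP cg ch.
pose F (x : V * V) := f x.1 + g x.2 + h x.
have [||| [p q]] := @compact_EVT_max _ R F (A `*` A).
- by exists (a, a).
- exact: compact_setX.
- apply/subspace_continuousP => -[p q] [/= Ap Aq].
  apply: cvgD; last by apply: cvg_within_filter; exact: ch.
  (* The projections carry the trace filter on the product to the trace filters on the factors. *)
  have c1 : fst @ within (A `*` A) (nbhs (p, q)) --> within A (nbhs p).
    move=> X AX; exists ([set x | A x -> X x], setT) => /=.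
      by split => //; exact: filterT.
    by move=> [x y] /= [AXx _] [Ax _]; exact: AXx.
  have c2 : snd @ within (A `*` A) (nbhs (p, q)) --> within A (nbhs q).
    move=> X AX; exists (setT, [set x | A x -> X x]) => /=.
      by split => //; exact: filterT.
    by move=> [x y] /= [_ AXy] [_ Ay]; exact: AXy.
  by apply: cvgD; [exact: cvg_comp c1 (cf p Ap) | exact: cvg_comp c2 (cg q Aq)].
by rewrite inE => -[/= Ap Aq] Fmax; exists p, q; split => // p' q' Ap' Aq';
   apply: (Fmax (p', q')); rewrite inE.
Qed.

End Compactness.

(** * The simplex, its compactness and its relative interior *)

Section Simplex.
Context {R : realType} {n : nat}.
Implicit Types p q z : 'rV[R]_n.

Definition open_simplex : set 'rV[R]_n :=
  [set p | (forall i, 0 < p 0 i) /\ \sum_(i < n) p 0 i = 1].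

Lemma open_simplexW p : open_simplex p -> simplex p.
Proof. by move=> [p0 p1]; split => // i; exact/ltW. Qed.

Lemma open_simplex_nbhs p : open_simplex p ->
  exists2 d, 0 < d &
    forall q, \sum_(i < n) q 0 i = 1 -> `|q - p| < d -> open_simplex q.
Proof.
move=> [p0 _].
have /filter_forall : forall i : 'I_n, nbhs p [set q : 'rV[R]_n | 0 < q 0 i].
  move=> i; have /cvgr_gt := @coord_continuous R 1 n 0 i p.
  by move=> /(_ _ (p0 i)).
move=> /nbhs_ballP[d /= d0 dp]; exists d => // q q1 qp; split => //.
by apply: dp; rewrite -ball_normE /= distrC.
Qed.

Lemma simplex_coord_le1 p i : simplex p -> p 0 i <= 1.
Proof. by move=> [p0 <-]; rewrite (bigD1 i)//= lerDl sumr_ge0. Qed.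

Lemma simplex_dot_le1 p : simplex p -> dot p p <= 1.
Proof.
move=> sp; have [p0 <-] := sp; apply: ler_sum => i _.
by rewrite ler_piMl// simplex_coord_le1.
Qed.

Lemma simplex_enorm_le1 p : simplex p -> enorm p <= 1.
Proof. by move=> /simplex_dot_le1 p1; rewrite -sqrtr1 ler_sqrt. Qed.

Lemma closed_simplex : closed (@simplex R n).
Proof.
have -> : @simplex R n =
    (\bigcap_(i in [set: 'I_n]) [set p : 'rV[R]_n | 0 <= p 0 i]) `&`
    [set p | \sum_(i < n) p 0 i = 1].
  rewrite predeqE => p; split => [[p0 p1]|[p0 p1]]; split => // i *; exact: p0.
apply: closedI.
  apply: closed_bigI => i _.
  apply: (@preimage_closed _ _ (fun p : 'rV[R]_n => p 0 i) [set x | 0 <= x]).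
    by move=> x _; exact: coord_continuous.
  exact: closed_ge.
apply: (@preimage_closed _ _ (fun p : 'rV[R]_n => \sum_(i < n) p 0 i) [set x | x = 1]).
  move=> x _; apply: differentiable_continuous.
  have -> : (fun p : 'rV[R]_n => \sum_(i < n) p 0 i) =
            \sum_(i < n) (fun p : 'rV[R]_n => p 0 i).
    by apply/funext => p; rewrite fct_sumE.
  by apply: differentiable_sum => i; exact: differentiable_coord.
exact: closed_eq.
Qed.

Lemma compact_simplex : compact (@simplex R n).
Proof.
apply: bounded_closed_compact; last exact: closed_simplex.
exists 1; split; first exact: num_real.
move=> M M1 p sp /=; rewrite (le_trans (normr_le_enorm _))//.
by rewrite (le_trans (simplex_enorm_le1 sp))// ltW.
Qed.

Lemma sum_shift p z (a : R) : \sum_(i < n) p 0 i = 1 -> \sum_(i < n) z 0 i = 0 ->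
  \sum_(i < n) (p + a *: z) 0 i = 1.
Proof.
move=> p1 z0; under eq_bigr do rewrite !mxE.
by rewrite big_split/= -big_distrr/= z0 mulr0 addr0.
Qed.

Lemma sum_sub p q : \sum_(i < n) p 0 i = 1 -> \sum_(i < n) q 0 i = 1 ->
  \sum_(i < n) (p - q) 0 i = 0.
Proof.
by move=> p1 q1; under eq_bigr do rewrite !mxE; rewrite sumrB p1 q1 subrr.
Qed.

(** No sign constraint is active at an interior point, so every direction of the hyperplane is
    admissible both ways. *)
Lemma open_simplex_tangent p z :
  open_simplex p -> \sum_(i < n) z 0 i = 0 -> tangent p z.
Proof.
move=> op z0; have [d d0 dp] := open_simplex_nbhs op; have [_ p1] := op.
have ez : 0 < 1 + `|z| by rewrite ltr_pwDl.
(* The 1 keeps the denominator positive at [z = 0] and makes e |z| < d strict. *)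
pose e := d / (1 + `|z|).
have e0 : 0 < e by rewrite divr_gt0.
have ezd : e * `|z| < d.
  rewrite /e mulrAC ltr_pdivrMr// ltr_pM2l//; lra.
exists e; split => //; apply: open_simplexW; apply: dp.
- exact: sum_shift.
- by rewrite addrAC subrr add0r normrZ gtr0_norm.
- by rewrite -scaleNr; exact: sum_shift.
- by rewrite addrAC subrr add0r normrN normrZ gtr0_norm.
Qed.

Lemma open_simplex_conv (a b : 'rV[R]_n) (t : R) :
  open_simplex a -> open_simplex b -> 0 <= t <= 1 ->
  open_simplex (a + t *: (b - a)).
Proof.
move=> [a0 a1] [b0 b1] /andP[t0 t1]; split; last exact/sum_shift/sum_sub.
move=> i; rewrite !mxE; have := a0 i; have := b0 i; nra.
Qed.

End Simplex.

(** * The viscosity inequalities tested with quadratics *)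

Section TestFunctions.
Context {R : realType} {n : nat}.
Variables (r : R) (H : 'rV[R]_n -> 'rV[R]_n -> R) (w : 'rV[R]_n -> R).
Implicit Types (A : 'M[R]_n) (b p q z : 'rV[R]_n) (k rho : R).

Lemma quadratic_center A b p : quadratic A b 0 p p = 0.
Proof. by rewrite /quadratic subrr mul0mx dot0l dotC dot0l !addr0. Qed.

Lemma local_max_quadratic A b p rho : simplex p -> 0 < rho ->
  (forall q, simplex q -> `|q - p| < rho ->
    w q <= w p + (dot ((q - p) *m A) (q - p) + dot b (q - p))) ->
  local_max_on simplex (fun q => w q - quadratic A b 0 p q) p.
Proof.
move=> sp rho0 wq; split => //; apply/nbhs_ballP; exists rho => //= q pq sq.
rewrite quadratic_center /quadratic subr0 addr0 lerBlDr.
by apply: wq => //; rewrite -ball_normE /= distrC in pq.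
Qed.

Lemma local_min_quadratic A b p rho : simplex p -> 0 < rho ->
  (forall q, simplex q -> `|q - p| < rho ->
    w p + (dot ((q - p) *m A) (q - p) + dot b (q - p)) <= w q) ->
  local_min_on simplex (fun q => w q - quadratic A b 0 p q) p.
Proof.
move=> sp rho0 wq; split => //; apply/nbhs_ballP; exists rho => //= q pq sq.
rewrite quadratic_center /quadratic subr0 addr0 lerBrDr.
by apply: wq => //; rewrite -ball_normE /= distrC in pq.
Qed.

(** The Hessian is -2k times the identity, so [lambda_max] is negative or [-oo] and the second entry
    of the minimum is positive; the first must then be nonpositive. *)
Lemma subsolution_concave_test b p k rho :
  viscosity_subsolution r H w -> simplex p -> 0 < k -> 0 < rho ->
  (forall q, simplex q -> `|q - p| < rho ->
    w q <= w p + dot b (q - p) - k * dot (q - p) (q - p)) ->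
  r * w p + H p b <= 0.
Proof.
move=> [_ wsub] sp k0 rho0 wq.
have /wsub : local_max_on simplex (fun q => w q - quadratic (- k)%:M b 0 p q) p.
  apply: (local_max_quadratic sp rho0) => q sq qp.
  by rewrite mul_mx_scalar dotZl; have := wq q sq qp; lra.
move=> /(_ (smooth_quadratic _ _ _ _)); rewrite /hj_operator.
rewrite gradient_quadratic hessian_quadratic ge_min lee_fin => /orP[//|].
rewrite leeNl oppe0 => lm.
have /(le_trans lm) : (lambda_max p ((- k)%:M + (- k)%:M^T) <= (- k)%:E)%E.
  apply: ge_ereal_sup => _ [z [_ z0] <-].
  rewrite tr_scalar_mx -raddfD /= mul_mx_scalar dotZl enorm_sqr mulfK ?dot_eq0//.
  by rewrite lee_fin; lra.
by rewrite lee_fin; lra.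
Qed.

(** Both entries of a nonnegative minimum are nonnegative; this keeps the first, whatever the sign
    of [k]. *)
Lemma supersolution_parabola_test b p k :
  viscosity_supersolution r H w -> simplex p ->
  (forall q, simplex q -> w p + dot b (q - p) - k * dot (q - p) (q - p) <= w q) ->
  0 <= r * w p + H p b.
Proof.
move=> [_ wsup] sp wq.
have /wsup : local_min_on simplex (fun q => w q - quadratic (- k)%:M b 0 p q) p.
  apply: (local_min_quadratic sp ltr01) => q sq _.
  by rewrite mul_mx_scalar dotZl; have := wq q sq; lra.
move=> /(_ (smooth_quadratic _ _ _ _)); rewrite /hj_operator.
by rewrite gradient_quadratic le_min lee_fin => /andP[].
Qed.

(** This keeps the second entry: [lambda_max] is nonpositive and bounds the Rayleigh quotient of
    [z], which is tangent since [p] is interior. *)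
Lemma supersolution_hessian_test A b p rho z :
  viscosity_supersolution r H w -> open_simplex p -> 0 < rho ->
  (forall q, simplex q -> `|q - p| < rho ->
    w p + (dot ((q - p) *m A) (q - p) + dot b (q - p)) <= w q) ->
  \sum_(i < n) z 0 i = 0 -> dot (z *m (A + A^T)) z <= 0.
Proof.
move=> [_ wsup] op rho0 wq zs.
have [->|z0] := eqVneq z 0; first by rewrite mul0mx dot0l.
have := wsup _ (smooth_quadratic A b 0 p) p.
move=> /(_ (local_min_quadratic (open_simplexW op) rho0 wq)); rewrite /hj_operator.
rewrite hessian_quadratic le_min => /andP[_]; rewrite leeNr oppe0 => lm.
have : ((dot (z *m (A + A^T)) z / enorm z ^+ 2)%:E <= 0)%E.
  apply: le_trans lm; apply: ereal_sup_ubound; exists z => //; split => //.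
  exact: open_simplex_tangent.
by rewrite lee_fin enorm_sqr pmulr_lle0// invr_gt0 dot_gt0.
Qed.

End TestFunctions.

(** * Interior concavity of the supersolution and its supergradients *)

Section Concavity.
Context {R : realType} {n : nat}.
Variables (r : R) (H : 'rV[R]_n -> 'rV[R]_n -> R) (w : 'rV[R]_n -> R).
Hypothesis w_cont : {within simplex, continuous w}.
Hypothesis w_super : viscosity_supersolution r H w.
Implicit Types (a b p q x xi : 'rV[R]_n) (d mu : R).

(* G is the excess of w over the chord of [a, b], made strictly convex along the
   segment and penalized by K times the squared distance to the line. If w goes
   below the chord, then for K large a minimizer q of G is close to an inner point
   of the segment, and the quadratic part of G is a forbidden test function. *)
Lemma supersolution_concave a b s : open_simplex a -> open_simplex b ->
  0 <= s <= 1 -> (1 - s) * w a + s * w b <= w (a + s *: (b - a)).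
Proof.
move=> oa ob s01; rewrite leNgt; apply/negP => lt_w.
have [e eE] : {e | e = b - a} by exists (b - a).
have lt_w' : w (a + s *: e) < (1 - s) * w a + s * w b by rewrite eE.
pose m := (1 - s) * w a + s * w b - w (a + s *: e).
have m0 : 0 < m by rewrite subr_gt0.
have e0 : e != 0.
  apply: contraTneq m0; rewrite /m => e0; rewrite e0 scaler0 addr0.
  by move: e0; rewrite eE => /subr0_eq ->; rewrite -leNgt; lra.
pose E := dot e e; have E0 : 0 < E by exact: dot_gt0.
(* Coordinate of the orthogonal projection of [q] on the line through [a] and [b]; the foot is
   [a + t q *: e]. *)
pose t q := dot (q - a) e / E.
have [B wB] : exists B, forall q, simplex q -> `|w q| <= B.
  exact: compact_fun_bounded compact_simplex w_cont.
have B0 : 0 <= B by rewrite (le_trans _ (wB a _))//; exact: open_simplexW.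
have [d1 d10 w_unif] :=
  compact_unif_continuous (@compact_simplex R n) w_cont (divr_gt0 m0 (ltr0Sn R 1)).
have [da da0 oda] := open_simplex_nbhs oa.
have [db db0 odb] := open_simplex_nbhs ob.
(* Below [d1], [w] varies by less than [m / 2]; below [da] and [db], translates of [a] and [b] stay
   interior. *)
pose d := Num.min d1 (Num.min da db).
have d0 : 0 < d by rewrite !lt_min d10 da0.
(* At distance [d] from the line the penalty exceeds 2B, the largest possible drop of [w] below the
   chord. *)
pose K := (2 * B + d ^+ 2) / d ^+ 2.
have Kd : K * d ^+ 2 = 2 * B + d ^+ 2 by rewrite /K divfK// expf_neq0// gt_eqF.
have K0 : 0 < K by rewrite divr_gt0 ?exprn_gt0// ltr_wpDl ?exprn_gt0// mulr_ge0.
(* The form of [M] at [q - a] is K times the squared distance to the line, minus m t^2. Its value at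
   [e] is [- m]. *)
pose M : 'M[R]_n := K%:M - ((m + K * E) / E ^+ 2) *: (e^T *m e).
have ME h : dot (h *m M) h = K * dot h h - (m + K * E) / E ^+ 2 * dot h e ^+ 2.
  rewrite mulmxBr mul_mx_scalar -scalemxAr dotDl dotNl !dotZl dot_rank1.
  by rewrite (dotC e h) -expr2.
pose G q := w q + quadratic M (((m - (w b - w a)) / E) *: e) (- w a) a q.
have GE q : G q = w q - ((1 - t q) * w a + t q * w b) + m * (t q * (1 - t q))
    + K * dot (q - (a + t q *: e)) (q - (a + t q *: e)).
  rewrite /G /quadratic ME (_ : q - (a + _) = q - a - t q *: e) ?opprD ?addrA//.
  have : dot (q - a) e = t q * E by rewrite /t divfK// gt_eqF.
  move: (t q) (q - a) => tq h heE.
  rewrite !(dotDl, dotDr, dotNl, dotNr, dotZl, dotZr) (dotC e h) -/E heE.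
  by field; rewrite gt_eqF.
pose D := simplex `&` [set q | 0 <= t q <= 1].
have t_cont : continuous t.
  move=> q; have -> : t = quadratic 0 (E^-1 *: e) 0 a.
    by apply/funext => x; rewrite /t /quadratic mulmx0 dot0l dotZl dotC; ring.
  exact/differentiable_continuous/differentiable_quadratic.
have cD : compact D.
  apply: (subclosed_compact _ (@compact_simplex R n)); last by move=> ? [].
  apply: closedI; first exact: closed_simplex.
  have -> : [set q | 0 <= t q <= 1] = t @^-1` `[0, 1]%classic.
    by apply/seteqP; split => q /=; rewrite in_itv.
  by apply: preimage_closed => [? _|]; [exact: t_cont | exact: interval_closed].
have G_cont : {within D, continuous G}.
  apply: within_continuousD.
    by apply: continuous_subspaceW w_cont => ? [].
  apply: continuous_subspaceT => q.
  exact/differentiable_continuous/differentiable_quadratic.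
have tE y : t (a + y *: e) = y.
  by rewrite /t addrAC subrr add0r dotZl mulfK// gt_eqF.
have Ds : D (a + s *: e).
  by split; [by rewrite eE; exact/open_simplexW/open_simplex_conv | rewrite /= tE].
have [|q] := EVT_min_rV _ cD G_cont; first by exists (a + s *: e).
rewrite inE => -[sq tq] Gmin.
pose y := a + t q *: e.
(* At the bad point the excess is [- m], and m s (1 - s) is at most m / 4. *)
have Gq : G q <= - (3 / 4 * m).
  apply: (le_trans (Gmin _ (mem_set Ds))); rewrite GE tE subrr dot0l.
  have -> : w (a + s *: e) = (1 - s) * w a + s * w b - m by rewrite /m; ring.
  have : 0 <= (s - 1 / 2) ^+ 2 by exact: sqr_ge0.
  nra.
have oy : open_simplex y by rewrite /y eE; exact: open_simplex_conv.
have qy : `|q - y| < d.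
  apply: (le_lt_trans (normr_le_enorm _)).
  rewrite ltNge; apply/negP => dq.
  have : d ^+ 2 <= dot (q - y) (q - y).
    by rewrite -enorm_sqr ler_pXn2r ?nnegrE ?enorm_ge0 ?(ltW d0).
  rewrite -(ler_pM2l K0) Kd => KD; move: Gq; rewrite GE -/y.
  have := wB _ sq; have := wB _ (open_simplexW oa); have := wB _ (open_simplexW ob).
  rewrite !ler_norml => /andP[b1 b2] /andP[a1 a2] /andP[q1 q2].
  move: tq => /andP[t0 t1] Gq.
  have : 0 <= m * (t q * (1 - t q)).
    by apply: mulr_ge0 (ltW m0) (mulr_ge0 t0 _); rewrite subr_ge0.
  have : (1 - t q) * w a <= (1 - t q) * B by rewrite ler_wpM2l ?subr_ge0.
  have : t q * w b <= t q * B by rewrite ler_wpM2l.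
  have : 0 < d ^+ 2 by rewrite exprn_gt0.
  lra.
have wqy : w y - m / 2 < w q.
  have /(w_unif _ _ sq (open_simplexW oy)) : `|q - y| < d1.
    by rewrite (lt_le_trans qy)// ge_min lexx.
  by rewrite ltr_norml => /andP[]; lra.
(* If the foot were [a] or [b], the chord would equal [w] there, and [wqy] would give G q > - m /
   2. *)
have tq01 : 0 < t q < 1.
  move: tq => /andP[]; rewrite !le_eqVlt.
  have KD : 0 <= K * dot (q - y) (q - y) by rewrite mulr_ge0 ?dot_ge0// ltW.
  move=> /orP[/eqP t0 _|-> /orP[/eqP t1|->//]]; exfalso.
    move: Gq wqy KD; rewrite GE /y -t0 scale0r addr0; lra.
  move: Gq wqy KD; rewrite GE /y t1 scale1r eE subrKC; lra.
(* [q] lies on the segment [a, b] translated by [q - y], whose ends are interior by the choice of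
   [d]. *)
have oq : open_simplex q.
  have sum_v : \sum_(i < n) (q - y) 0 i = 0.
    by apply: sum_sub; [case: sq | case: oy].
  have -> : q = (a + (1 : R) *: (q - y)) +
      t q *: ((b + (1 : R) *: (q - y)) - (a + (1 : R) *: (q - y))).
    have -> v : (b + (1 : R) *: v) - (a + (1 : R) *: v) = e.
      by rewrite opprD addrACA subrr addr0 eE.
    by rewrite scale1r addrAC -/y addrC subrK.
  apply: open_simplex_conv => //.
  - apply: oda; first by apply: sum_shift => //; case: oa.
    rewrite addrAC subrr add0r scale1r (lt_le_trans qy)//.
    by rewrite !ge_min lexx ?orbT.
  - apply: odb; first by apply: sum_shift => //; case: ob.
    rewrite addrAC subrr add0r scale1r (lt_le_trans qy)//.
    by rewrite !ge_min lexx ?orbT.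
(* Near [q] the slab condition holds, so minimality on [D] is local minimality on the simplex. *)
have [rho rho0 rhoD] : exists2 rho, 0 < rho &
    forall x, `|x - q| < rho -> 0 <= t x <= 1.
  have [t0 t1] := andP tq01.
  have N0 : \forall x \near q, 0 < t x by have /cvgr_gt := t_cont q; apply.
  have N1 : \forall x \near q, t x < 1 by have /cvgr_lt := t_cont q; apply.
  have /nbhs_ballP[rho /= rho0 rhoP] :
      nbhs q ([set x | 0 < t x] `&` [set x | t x < 1]) by exact: filterI.
  exists rho => // x xq; have [|? ?] := rhoP x; last by rewrite !ltW.
  by rewrite -ball_normE /= distrC.
pose g := (q - a) *m (M + M^T) + ((m - (w b - w a)) / E) *: e.
have test x : simplex x -> `|x - q| < rho ->
    w q + (dot ((x - q) *m - M) (x - q) + dot (- g) (x - q)) <= w x.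
  move=> sx xq; have := Gmin x (mem_set (conj sx (rhoD x xq))).
  rewrite /G -{2}(subrK q x) -[X in X + q]scale1r quadratic_expand.
  rewrite expr1n !mul1r -dotDl -/g mulmxN !dotNl; lra.
(* Along [e] the Hessian of the test function has value 2m > 0, a contradiction. *)
have := supersolution_hessian_test w_super oq rho0 test (z := e) _.
rewrite dot_symmetrize mulmxN dotNl ME -/E divfK ?expf_neq0 ?gt_eqF//.
move=> /(_ _); have -> : \sum_(i < n) e 0 i = 0.
  by rewrite eE; apply: sum_sub; [case: ob | case: oa].
by move=> /(_ erefl); lra.
Qed.

(** If the inequality fails at [x] by [c], step past [q] to a = q - t h with h = x - q. Concavity on
    [a, x] bounds [w a] above, the parabola bounds it below, and together they give c <= t K |h|^2,
    false for small [t]. *)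
Lemma supersolution_supergradient q xi K : open_simplex q ->
  (forall x, simplex x ->
    w q + dot xi (x - q) - K * dot (x - q) (x - q) <= w x) ->
  forall x, open_simplex x -> w x <= w q + dot xi (x - q).
Proof.
move=> oq wq x ox; rewrite leNgt; apply/negP; rewrite -subr_gt0 => c0.
set c := _ - _ in c0; pose h := x - q.
have [d d0 od] := open_simplex_nbhs oq.
pose X := `|h|; pose Y := `|K| * dot h h.
have X0 : 0 <= X by exact: normr_ge0.
have Y0 : 0 <= Y by rewrite mulr_ge0 ?dot_ge0.
(* Small enough that t X < d keeps [a] interior and t Y < c gives the contradiction. *)
pose t := Num.min d c / (1 + X + Y).
have m0 : 0 < Num.min d c by rewrite lt_min d0.
have XY : 0 < 1 + X + Y by lra.
have t0 : 0 < t by rewrite divr_gt0.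
have tXY : t + t * X + t * Y = Num.min d c.
  by rewrite -{1}(mulr1 t) -!mulrDr /t divfK// gt_eqF.
have tX0 : 0 <= t * X by rewrite mulr_ge0// ltW.
have tY0 : 0 <= t * Y by rewrite mulr_ge0// ltW.
have tXd : t * X < d.
  have : Num.min d c <= d by rewrite ge_min lexx.
  lra.
have tYc : t * Y < c.
  have : Num.min d c <= c by rewrite ge_min lexx orbT.
  lra.
pose a := q + (- t) *: h.
have oa : open_simplex a.
  apply: od.
    apply: sum_shift; first by case: oq.
    by apply: sum_sub; [case: ox | case: oq].
  by rewrite /a addrAC subrr add0r normrZ normrN gtr0_norm.
have t10 : 0 < 1 + t by rewrite addr_gt0.
(* This ratio is the parameter of [q] on the segment from [a] to [x]. *)
have s01 : 0 <= t / (1 + t) <= 1.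
  apply/andP; split; first by apply: divr_ge0; exact: ltW.
  by rewrite ler_pdivrMr// mul1r lerDr.
have := supersolution_concave oa ox s01.
have -> : x - a = (1 + t) *: h.
  by rewrite /a scaleNr opprB addrA addrAC -/h scalerDl scale1r.
rewrite scalerA divfK ?gt_eqF// /a scaleNr subrK -scaleNr -/a => cc.
have {}cc : w a + t * w x <= (1 + t) * w q.
  rewrite -(ler_pM2l t10) in cc; apply: le_trans cc.
  by rewrite le_eqVlt; apply/orP; left; apply/eqP; field; rewrite gt_eqF.
have aqE : a - q = (- t) *: h by rewrite /a addrAC subrr add0r.
have := wq a (open_simplexW oa).
rewrite aqE !(dotZl, dotZr) => wa.
have KY : t * (t * (K * dot h h)) <= t * (t * Y).
  by rewrite !ler_pM2l// ler_wpM2r ?dot_ge0// ler_norm.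
have tc : t * (t * Y) < t * c by rewrite ltr_pM2l.
have : t * c = t * w x - t * w q - t * dot xi h by rewrite /c; ring.
by move=> tcE; lra.
Qed.

(* Test the supergradient inequality at q - d xi / |xi|, which is interior. *)
Lemma supergradient_bound q xi d mu : simplex q -> 0 < d ->
  (forall i, d < q 0 i) -> \sum_(i < n) xi 0 i = 0 ->
  (forall x y, simplex x -> simplex y -> `|x - y| < 2 * d ->
    `|w x - w y| < mu) ->
  (forall x, open_simplex x -> w x <= w q + dot xi (x - q)) ->
  d * enorm xi <= mu.
Proof.
move=> sq d0 qd xi0 w_unif wq.
have [xi00|xi_neq0] := eqVneq (enorm xi) 0.
  rewrite xi00 mulr0 (le_trans (normr_ge0 (w q - w q)))// ltW// w_unif//.
  by rewrite subrr normr0 mulr_gt0.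
have xi_gt0 : 0 < enorm xi by rewrite lt_neqAle enorm_ge0 eq_sym xi_neq0.
pose x := q + (- (d / enorm xi)) *: xi.
have xqE : x - q = (- (d / enorm xi)) *: xi by rewrite /x addrAC subrr add0r.
have xq : enorm (x - q) = d.
  by rewrite xqE enormZ normrN gtr0_norm ?divr_gt0// divfK.
have ox : open_simplex x.
  split; last by apply: sum_shift => //; case: sq.
  move=> i; have := coord_le_enorm (x - q) i; have := qd i.
  rewrite xq ler_norml => qi /andP[xi1 _]; move: xi1; rewrite !mxE; lra.
have xq2 : `|x - q| < 2 * d.
  by rewrite (le_lt_trans (normr_le_enorm _))// xq; lra.
have := w_unif _ _ (open_simplexW ox) sq xq2.
rewrite ltr_norml => /andP[wx _]; have := wq x ox.
rewrite xqE dotZr -enorm_sqr mulNr expr2 mulrA divfK//; lra.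
Qed.

End Concavity.

(** * Doubling of variables with a contracted first variable *)

Section Doubling.
Context {R : realType} {n : nat}.
Variables (r : R) (H : 'rV[R]_n -> 'rV[R]_n -> R) (w1 w2 : 'rV[R]_n -> R).
Hypothesis w2_cont : {within simplex, continuous w2}.
Hypothesis w1_sub : viscosity_subsolution r H w1.
Hypothesis w2_super : viscosity_supersolution r H w2.
Implicit Types (p q x : 'rV[R]_n) (eta kap K : R).

(** The constant row is the barycenter; for [n = 0] the inverse is 0 by convention and the simplex
    is empty. *)
Definition contraction eta p : 'rV[R]_n :=
  (1 - eta) *: p + eta *: const_mx n%:R^-1.

Lemma simplex_dim_gt0 p : simplex p -> (0 < n)%N.
Proof.
move=> [_]; case: (n) p => // p; rewrite big_ord0 => /esym/eqP.
by rewrite oner_eq0.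
Qed.

Lemma simplex_barycenter : (0 < n)%N -> simplex (const_mx n%:R^-1 : 'rV[R]_n).
Proof.
move=> n0; split; first by move=> i; rewrite mxE invr_ge0.
under eq_bigr do rewrite mxE.
by rewrite sumr_const card_ord -[LHS]mulr_natr mulVf// pnatr_eq0 -lt0n.
Qed.

Lemma contraction_coord eta p i : eta <= 1 -> simplex p ->
  eta / n%:R <= contraction eta p 0 i.
Proof. by move=> eta1 [p0 _]; rewrite !mxE lerDr mulr_ge0// subr_ge0. Qed.

Lemma contraction_simplex eta p : 0 <= eta <= 1 -> simplex p ->
  simplex (contraction eta p).
Proof.
move=> /andP[eta0 eta1] sp.
have [_ c1] := simplex_barycenter (simplex_dim_gt0 sp); have [_ p1] := sp.
split; last first.
  under eq_bigr do rewrite mxE [X in X + _]mxE [X in _ + X]mxE.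
  by rewrite big_split/= -!big_distrr/= p1 c1 !mulr1 subrK.
by move=> i; apply: le_trans (contraction_coord i eta1 sp); rewrite divr_ge0.
Qed.

Lemma contraction_dist eta p : 0 <= eta -> simplex p ->
  enorm (contraction eta p - p) <= 2 * eta.
Proof.
move=> eta0 sp.
have sc := simplex_barycenter (simplex_dim_gt0 sp).
have -> : contraction eta p - p = eta *: (const_mx n%:R^-1 + - p).
  by apply/rowP => i; rewrite !mxE; ring.
rewrite enormZ ger0_norm// mulrC ler_wpM2r// (le_trans (enormD _ _))// enormN.
have := simplex_enorm_le1 sp; have := simplex_enorm_le1 sc; lra.
Qed.

(** The [kap] term is what makes the function touching [w1] from above strictly concave. *)
Definition penalized eta kap K (pq : 'rV[R]_n * 'rV[R]_n) : R :=
  w1 pq.1 - w2 pq.2 + (kap * dot pq.1 pq.1 -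
    K * dot (contraction eta pq.1 - pq.2) (contraction eta pq.1 - pq.2)).

(** * First-order inequalities at a maximum point *)

Section Maximum.
Variables (eta kap K : R) (p q : 'rV[R]_n).
Hypothesis eta01 : 0 < eta < 1.
Hypothesis kap_gt0 : 0 < kap.
Hypothesis p_simplex : simplex p.
Hypothesis q_open : open_simplex q.
Hypothesis pq_max : forall x y, simplex x -> simplex y ->
  penalized eta kap K (x, y) <= penalized eta kap K (p, q).

Let xi := (2 * K) *: (contraction eta p - q).

(** Freeze [p], vary the second variable alone and expand the square of the penalty. *)
Lemma penalized_max_touch x : simplex x ->
  w2 q + dot xi (x - q) - K * dot (x - q) (x - q) <= w2 x.
Proof.
move=> sx; have := pq_max p_simplex sx; rewrite /penalized /=.
rewrite /xi; set u := contraction eta p.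
have -> : u - x = (u - q) - (x - q) by rewrite opprB addrA subrK.
move: (u - q) (x - q) => v h.
rewrite !(dotDl, dotDr, dotNl, dotNr, dotZl) (dotC h v); lra.
Qed.

Lemma penalized_max_supersolution : 0 <= r * w2 q + H q xi.
Proof.
apply: (supersolution_parabola_test w2_super (open_simplexW q_open)).
exact: penalized_max_touch.
Qed.

Lemma penalized_max_supergradient x :
  open_simplex x -> w2 x <= w2 q + dot xi (x - q).
Proof.
apply: (supersolution_supergradient w2_cont w2_super q_open).
exact: penalized_max_touch.
Qed.

(* Moving p by h and q by (1 - eta) h leaves the penalty unchanged. *)
Lemma penalized_max_subsolution :
  r * w1 p + H p ((1 - eta) *: xi - (2 * kap) *: p) <= 0.
Proof.
have [e0 e1] := andP eta01.
have [d d0 qd] := open_simplex_nbhs q_open.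
apply: (subsolution_concave_test w1_sub p_simplex kap_gt0 d0) => x sx xp.
pose y := q + (1 - eta) *: (x - p).
have oy : open_simplex y.
  apply: qd.
    apply: sum_shift; first by case: q_open.
    by apply: sum_sub; [case: sx | case: p_simplex].
  rewrite /y addrAC subrr add0r normrZ gtr0_norm ?subr_gt0//.
  rewrite (le_lt_trans _ xp)// ler_piMl//; lra.
have := pq_max sx (open_simplexW oy); rewrite /penalized /=.
have -> : contraction eta x - y = contraction eta p - q.
  by apply/rowP => i; rewrite !mxE; ring.
have := penalized_max_supergradient oy.
have -> : y - q = (1 - eta) *: (x - p) by rewrite /y addrAC subrr add0r.
(* This expansion yields both the -2 kap p in the gradient and the strictly concave term. *)
have : dot x x = dot p p + 2 * dot p (x - p) + dot (x - p) (x - p).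
  by rewrite !(dotDl, dotDr, dotNl, dotNr) (dotC x p); ring.
move: (dot x x) (x - p) => xx h ->.
rewrite !(dotDl, dotNl, dotZl, dotZr); lra.
Qed.

End Maximum.

Lemma penalized_max_ex eta kap K : {within simplex, continuous w1} ->
  @simplex R n !=set0 ->
  exists p q, [/\ simplex p, simplex q & forall x y, simplex x -> simplex y ->
    penalized eta kap K (x, y) <= penalized eta kap K (p, q)].
Proof.
move=> w1_cont s0.
have w2N_cont : {within simplex, continuous (fun x => - w2 x)}.
  by move=> x; apply: cvgN; exact: w2_cont.
have h_cont : continuous (fun pq : 'rV[R]_n * 'rV[R]_n => kap * dot pq.1 pq.1 -
    K * dot (contraction eta pq.1 - pq.2) (contraction eta pq.1 - pq.2)).
  have c1 i : continuous (fun pq : 'rV[R]_n * 'rV[R]_n => pq.1 0 i).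
    move=> pq; apply: (@continuous_comp _ _ _ fst (fun x : 'rV[R]_n => x 0 i)).
      exact: cvg_fst.
    exact: coord_continuous.
  have c2 i : continuous (fun pq : 'rV[R]_n * 'rV[R]_n => pq.2 0 i).
    move=> pq; apply: (@continuous_comp _ _ _ snd (fun x : 'rV[R]_n => x 0 i)).
      exact: cvg_snd.
    exact: coord_continuous.
  have cT i : continuous (fun pq : 'rV[R]_n * 'rV[R]_n =>
      (contraction eta pq.1 - pq.2) 0 i).
    have -> : (fun pq : 'rV[R]_n * 'rV[R]_n =>
        (contraction eta pq.1 - pq.2) 0 i) =
      (fun pq => (1 - eta) * pq.1 0 i + eta * n%:R^-1 - pq.2 0 i).
      by apply/funext => pq; rewrite !mxE.
    move=> pq; apply: cvgB; last exact: c2.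
    by apply: cvgD; [apply: cvgM; [exact: cvg_cst | exact: c1] | exact: cvg_cst].
  have cd := continuous_dot c1 c1; have cdT := continuous_dot cT cT.
  move=> pq; apply: cvgB.
    by apply: cvgM; [exact: cvg_cst | exact: cd].
  by apply: cvgM; [exact: cvg_cst | exact: cdT].
have [p [q [sp sq pqM]]] :=
  compact_pair_max s0 (@compact_simplex R n) w1_cont w2N_cont h_cont.
by exists p, q; split => // x y sx sy; exact: pqM.
Qed.

(** * Choice of the parameters and comparison *)

Hypothesis r_gt0 : 0 < r.
Hypothesis w1_cont : {within simplex, continuous w1}.
Variable C : R.
Hypothesis C_ge0 : 0 <= C.
Hypothesis H_lipr : forall p q q', simplex p ->
  `|H p q - H p q'| <= C * enorm (q - q').
Hypothesis H_lipl : forall p p' q, simplex p -> simplex p' ->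
  `|H p q - H p' q| <= C * enorm (p - p') * (enorm q + 1).

(** Subtracting the two first-order inequalities gives r (w1 p - w2 q) <= H q xi - H p zeta. The
    left side is at least r (M - 2 th), the right side at most 11 C th. *)
Lemma viscosity_comparison p0 : simplex p0 -> w1 p0 <= w2 p0.
Proof.
move=> sp0; rewrite leNgt; apply/negP; rewrite -subr_gt0.
have C0 := C_ge0; have r0 := r_gt0.
set M := w1 p0 - w2 p0 => M0.
have N1 : 1 <= n%:R :> R by rewrite ler1n (simplex_dim_gt0 sp0).
have N0 : 0 < n%:R :> R by rewrite (lt_le_trans ltr01).
(* Chosen so that all errors, 11 C th + 2 r th, add up to r M / 2. *)
pose th := r * M / (2 * (11 * C + 2 * r)).
have den0 : 0 < 2 * (11 * C + 2 * r). by lra.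
have th0 : 0 < th by rewrite divr_gt0// mulr_gt0.
have thE : 11 * C * th + 2 * r * th = r * M / 2.
  by rewrite /th; field; rewrite gt_eqF//; lra.
(* Since eta = 2 n d, the bound d |xi| <= mu becomes eta |xi| <= 2 th. *)
pose mu := th / n%:R.
have mu0 : 0 < mu by rewrite divr_gt0.
have muth : mu <= th by rewrite ler_pdivrMr// ler_peMr// ltW.
have [d0 d00 w2_unif] := compact_unif_continuous (@compact_simplex R n) w2_cont mu0.
(* The bound d0 / 4 puts [contraction eta p0] within [d0] of [p0], and makes 2 d < d0. *)
pose eta := Num.min th (Num.min (1 / 2) (d0 / 4)).
have eta0 : 0 < eta by rewrite !lt_min th0; apply/andP; split; lra.
have etath : eta <= th by rewrite ge_min lexx.
have eta12 : eta <= 1 / 2 by rewrite !ge_min lexx orbT.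
have etad : eta <= d0 / 4 by rewrite !ge_min lexx !orbT.
have eta01 : 0 < eta < 1 by rewrite eta0 /=; lra.
have eta01' : 0 <= eta <= 1 by rewrite !ltW//; case/andP: eta01.
(* Half the lower bound on the coordinates of [contraction eta p]: if [q] is within [d] of it, its
   coordinates exceed [d]. *)
pose d := eta / (2 * n%:R).
have dE : 2 * n%:R * d = eta by rewrite /d mulrC divfK// mulf_neq0// gt_eqF.
have dp : 0 < d by rewrite divr_gt0// mulr_gt0.
have deta : 2 * d <= eta by rewrite -dE; nra.
have [B1 w1B] := compact_fun_bounded (@compact_simplex R n) w1_cont.
have [B2 w2B] := compact_fun_bounded (@compact_simplex R n) w2_cont.
have B10 : 0 <= B1 by exact: le_trans (w1B _ sp0).
have B20 : 0 <= B2 by exact: le_trans (w2B _ sp0).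
(* [Y] bounds |xi| independently of [K], so [K] may be chosen after it: [K1] forces |u| < d, and
   [K2] forces |u| (|xi| + 1) <= th through |xi| = 2 K |u|. *)
pose Y := mu / d; have Y0 : 0 < Y by rewrite divr_gt0.
pose K1 := (2 * B1 + 2 * B2 + th) / d ^+ 2.
pose K2 := Y * (Y + 1) / th.
have K1d : K1 * d ^+ 2 = 2 * B1 + 2 * B2 + th.
  by rewrite /K1 divfK// expf_neq0// gt_eqF.
have K2th : K2 * th = Y * (Y + 1) by rewrite /K2 divfK// gt_eqF.
have K10 : 0 < K1 by rewrite divr_gt0 ?exprn_gt0//; lra.
have K20 : 0 < K2 by rewrite divr_gt0// mulr_gt0// addr_gt0.
pose K := K1 + K2 + 1.
have K0 : 0 < K by rewrite /K; lra.
have s0 : @simplex R n !=set0 by exists p0.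
have [p [q [sp sq pq_max]]] := penalized_max_ex eta th K w1_cont s0.
have sTp := contraction_simplex eta01' sp.
have sTp0 := contraction_simplex eta01' sp0.
pose u := contraction eta p - q.
have uE : enorm u ^+ 2 = dot u u by exact: enorm_sqr.
(* The competitor is [p0] paired with its contraction, where the penalty vanishes. *)
have := pq_max _ _ sp0 sTp0; rewrite /penalized /= subrr dot0l -/u mulr0 subr0 -uE.
have ppth : th * dot p p <= th by rewrite ler_piMr ?simplex_dot_le1// ltW.
have p0p0 : 0 <= th * dot p0 p0 by rewrite mulr_ge0 ?dot_ge0// ltW.
move=> max0.
have ud : enorm u < d.
  rewrite ltNge; apply/negP => du.
  have : d ^+ 2 <= enorm u ^+ 2 by rewrite ler_pXn2r ?nnegrE ?enorm_ge0 ?(ltW dp).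
  rewrite -(ler_pM2l K0) => Kdu.
  have d20 : 0 < d ^+ 2 by rewrite exprn_gt0.
  have Kd : K1 * d ^+ 2 < K * d ^+ 2 by rewrite ltr_pM2r// /K; lra.
  have := w1B _ sp; have := w1B _ sp0; have := w2B _ sq; have := w2B _ sTp0.
  rewrite !ler_norml => /andP[? ?] /andP[? ?] /andP[? ?] /andP[? ?]; lra.
have qd i : d < q 0 i.
  have etaN : eta / n%:R = 2 * d by rewrite -dE; field; rewrite gt_eqF.
  have := contraction_coord i (proj2 (andP eta01')) sp.
  have := le_lt_trans (coord_le_enorm u i) ud; rewrite etaN ltr_norml.
  by rewrite /u [u 0 i]mxE [X in _ + X]mxE => /andP[_]; lra.
have oq : open_simplex q.
  by split; [move=> i; exact: lt_trans (qd i) | case: sq].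
pose xi := (2 * K) *: u.
have xi_sum : \sum_(i < n) xi 0 i = 0.
  under eq_bigr do rewrite mxE; rewrite -big_distrr/= sum_sub ?mulr0//.
    by case: sTp.
  by case: sq.
have sup_q := penalized_max_supersolution sp oq pq_max.
have sub_p := penalized_max_subsolution eta01 th0 sp oq pq_max.
rewrite -/u -/xi in sup_q sub_p.
pose X := enorm xi; have X0 : 0 <= X by exact: enorm_ge0.
have dX : d * X <= mu.
  apply: (supergradient_bound sq dp qd xi_sum (w := w2)).
    move=> x y sx sy xy; apply: w2_unif => //; lra.
  by move=> x ox; exact: (penalized_max_supergradient sp oq pq_max ox).
have XY : X <= Y by rewrite ler_pdivlMr// mulrC.
have etaX : eta * X <= 2 * th.
  rewrite -dE -mulrA; have -> : 2 * th = 2 * n%:R * mu.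
    by rewrite /mu; field; rewrite gt_eqF.
  by rewrite ler_pM2l// mulr_gt0.
have uX : enorm u * (X + 1) <= th.
  have XE : X = 2 * K * enorm u by rewrite /X /xi enormZ gtr0_norm// mulr_gt0.
  have : X * (X + 1) <= Y * (Y + 1) by rewrite ler_pM// ?addr_ge0// lerD2r.
  rewrite -K2th {1}XE -(mulrA (2 * K)) => le2.
  have K2_gt0 : 0 < 2 * K by rewrite mulr_gt0.
  by rewrite -(ler_pM2l K2_gt0) (le_trans le2)// ler_pM2r// /K; lra.
have wTp0 : w2 (contraction eta p0) - w2 p0 < mu.
  rewrite (le_lt_trans (ler_norm _))// w2_unif//.
  rewrite (le_lt_trans (normr_le_enorm _))//.
  by have := contraction_dist (ltW eta0) sp0; lra.
have gap : M - 2 * th <= w1 p - w2 q.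
  have : 0 <= K * enorm u ^+ 2 by rewrite mulr_ge0 ?sqr_ge0// ltW.
  rewrite /M; lra.
pose zeta := (1 - eta) *: xi - (2 * th) *: p.
have qp : enorm (q - p) <= enorm u + 2 * eta.
  have -> : q - p = - u + (contraction eta p - p).
    by rewrite /u opprB addrA subrK.
  rewrite (le_trans (enormD _ _))// enormN lerD2l.
  exact: contraction_dist (ltW eta0) sp.
have xz : enorm (xi - zeta) <= eta * X + 2 * th.
  have -> : xi - zeta = eta *: xi + (2 * th) *: p.
    by apply/rowP => i; rewrite !mxE; ring.
  rewrite (le_trans (enormD _ _))// (enormZ eta) (enormZ (2 * th)) (gtr0_norm eta0).
  have th20 : 0 < 2 * th by lra.
  by rewrite (gtr0_norm th20) lerD2l ler_piMr ?simplex_enorm_le1// ltW.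
(* The base point is changed first, at gradient [xi]; then the gradient, at base point [p]. *)
have H1 : H q xi - H p xi <= C * ((enorm u + 2 * eta) * (X + 1)).
  rewrite (le_trans (ler_norm _))// (le_trans (H_lipl _ sq sp))// -mulrA.
  by rewrite ler_wpM2l// ler_wpM2r// addr_ge0.
have H2 : H p xi - H p zeta <= C * (eta * X + 2 * th).
  rewrite (le_trans (ler_norm _))// (le_trans (H_lipr _ _ sp))//.
  by rewrite ler_wpM2l.
(* The 11 is 1 from |u| (X + 1), 6 from 3 eta X, 2 from 2 eta and 2 from 2 th. *)
have H3 : C * ((enorm u + 2 * eta) * (X + 1)) + C * (eta * X + 2 * th)
    <= C * (11 * th).
  rewrite -mulrDr ler_wpM2l//; nra.
have : r * (M - 2 * th) <= r * (w1 p - w2 q) by rewrite ler_pM2l.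
have rM : 0 < r * M by rewrite mulr_gt0.
rewrite -/zeta in sub_p; lra.
Qed.

End Doubling.

Theorem theorem6 (R : realType) (S : finType) (r : R)
  (H : 'rV[R]_#|S| -> 'rV[R]_#|S| -> R) (w1 w2 : 'rV[R]_#|S| -> R)
  (r_gt0 : 0 < r)
  (H_cont : {within simplex `*` setT,
     continuous (fun pq : 'rV[R]_#|S| * 'rV[R]_#|S| => H pq.1 pq.2)})
  (H_lip : exists C : R,
     (forall p q q', simplex p -> `|H p q - H p q'| <= C * enorm (q - q')) /\
     (forall p p' q, simplex p -> simplex p' ->
        `|H p q - H p' q| <= C * enorm (p - p') * (enorm q + 1)))
  (w1_cont : {within simplex, continuous w1})
  (w2_cont : {within simplex, continuous w2})
  (w1_sub : viscosity_subsolution r H w1)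
  (w2_super : viscosity_supersolution r H w2) :
  forall p, simplex p -> w1 p <= w2 p.
Proof.
have [C [H_lipr H_lipl]] := H_lip.
(* [C] is replaced by its absolute value to have a nonnegative constant. *)
apply: (viscosity_comparison w2_cont w1_sub w2_super r_gt0 w1_cont (normr_ge0 C)).
  move=> p q q' sp; apply: le_trans (H_lipr p q q' sp) _.
  by rewrite ler_wpM2r ?enorm_ge0 ?ler_norm.
move=> p p' q sp sp'; apply: le_trans (H_lipl p p' q sp sp') _.
by rewrite -!mulrA ler_wpM2r ?ler_norm// mulr_ge0 ?addr_ge0 ?enorm_ge0.
Qed.
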